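(* Let $\mathcal{X}\subset\mathbb{R}^D$, let $\mathcal{D}$ be a probability distribution on $\mathcal{X}$, and let $\mathcal{S}=\{\mathbf{x}_1,\dots,\mathbf{x}_n\}$ consist of $n$ i.i.d. samples from $\mathcal{D}$. Let $N_\phi,N_\theta$ be positive integers and let $\ell:\mathbb{R}^{N_\phi}\times\mathbb{R}^{N_\theta}\times\mathcal{X}\to[0,1]$ be a measurable loss, with $R(\phi,\theta)=\mathbb{E}_{\mathbf{x}\sim\mathcal{D}}[\ell(\phi,\theta,\mathbf{x})]$ and $\widehat{R}_{\mathcal{S}}(\phi,\theta)=\frac1n\sum_{i=1}^n\ell(\phi,\theta,\mathbf{x}_i)$. Let $\delta\in(0,1)$, fix $\phi^0\in\mathbb{R}^{N_\phi}$, $\theta^0\in\mathbb{R}^{N_\theta}$, $\sigma_\phi^2>0$, $\sigma_\theta^2>0$ independently of $\mathcal{S}$, and let $(\phi,\theta)=(\phi(\mathcal{S}),\theta(\mathcal{S}))$ be the output of a (measurable) learning algorithm given the dataset $\mathcal{S}$. Then with probability at least $1-\delta$ over both $\mathcal{S}\sim\mathcal{D}^n$ and independent $\varepsilon_\phi\sim\mathcal{N}(0,\sigma^2_\phi I_{N_\phi})$, $\varepsilon_\theta\sim\mathcal{N}(0,\sigma^2_\theta I_{N_\theta})$, \begin{multline*} \mathrm{kl}\left(\widehat{R}_{\mathcal{S}}(\phi+\varepsilon_\phi,\theta+\varepsilon_\theta)\,\|\,R(\phi+\varepsilon_\phi,\theta+\varepsilon_\theta)\right) \\ \leq \frac{\|\phi-\phi^0+\varepsilon_\phi\|_2^2-\|\varepsilon_\phi\|_2^2}{2\sigma^2_\phi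 n} + \frac{\|\theta-\theta^0+\varepsilon_\theta\|_2^2-\|\varepsilon_\theta\|_2^2}{2\sigma^2_\theta n} + \frac{\log(2\sqrt{n}/\delta)}{n}. \end{multline*}
   Context: $\mathrm{kl}$ denotes the binary Kullback--Leibler divergence $\mathrm{kl}(q\|p)=q\log\frac{q}{p}+(1-q)\log\frac{1-q}{1-p}$ for $q,p\in(0,1)$ (extended by continuity / the usual conventions). In the paper $\phi,\theta$ are the encoder and decoder weights of a (pseudo-)variational autoencoder, the algorithm is the one minimising a PAC-Bayes objective, and $\ell$ is a rescaled truncated reconstruction loss with values in $[0,1]$; only boundedness and measurability are used. *)

(* Defs.v *)
From HB Require Import structures.
From mathcomp Require Import all_boot all_order all_algebra.
From mathcomp Require Import all_classical all_reals all_analysis.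

Set Implicit Arguments.
Unset Strict Implicit.
Unset Printing Implicit Defensive.

Import Order.TTheory GRing.Theory Num.Theory.
Local Open Scope classical_set_scope.
Local Open Scope ring_scope.

(* Parameter vectors in R^N are represented as N.-tuple R, which carries the
   product (Borel) sigma-algebra in MathComp-Analysis. *)
Definition vadd (R : realType) (N : nat) (u v : N.-tuple R) : N.-tuple R :=
  [tuple tnth u i + tnth v i | i < N].

Definition vsub (R : realType) (N : nat) (u v : N.-tuple R) : N.-tuple R :=
  [tuple tnth u i - tnth v i | i < N].

Definition sqnorm (R : realType) (N : nat) (u : N.-tuple R) : R :=
  \sum_(i < N) tnth u i ^+ 2.

Definition xlogxy (R : realType) (a b : R) : \bar R :=
  if a == 0 then 0%E else if b == 0 then +oo%E else (a * ln (a / b))%:E.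

Definition kl (R : realType) (q p : R) : \bar R :=
  (xlogxy q p + xlogxy (1 - q) (1 - p))%E.

Definition risk d (T : measurableType d) (R : realType) (D : probability T R)
  (Np Nt : nat) (l : Np.-tuple R -> Nt.-tuple R -> T -> R)
  (a : Np.-tuple R) (b : Nt.-tuple R) : R :=
  fine (\int[D]_x (l a b x)%:E)%E.

Definition emp_risk d (T : measurableType d) (R : realType) (n Np Nt : nat)
  (l : Np.-tuple R -> Nt.-tuple R -> T -> R) (s : n.-tuple T)
  (a : Np.-tuple R) (b : Nt.-tuple R) : R :=
  (n%:R)^-1 * \sum_(i < n) l a b (tnth s i).

(* Mutual independence of the family of random variables
   X_1..X_n (values in T), E_1..E_Np and F_1..F_Nt (real valued), defined on
   the probability space (Omega, P): product rule for every choice of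
   measurable events (taking whole spaces gives every subfamily). *)
Definition mutually_independent d dO (T : measurableType d)
  (Omega : measurableType dO) (R : realType) (P : probability Omega R)
  (n Np Nt : nat) (X : 'I_n -> Omega -> T) (E : 'I_Np -> Omega -> R)
  (F : 'I_Nt -> Omega -> R) : Prop :=
  forall (A : 'I_n -> set T) (B : 'I_Np -> set R) (C : 'I_Nt -> set R),
    (forall i, measurable (A i)) -> (forall j, measurable (B j)) ->
    (forall k, measurable (C k)) ->
    P ((\bigcap_(i in [set: 'I_n]) (X i @^-1` A i)) `&`
       (\bigcap_(j in [set: 'I_Np]) (E j @^-1` B j)) `&`
       (\bigcap_(k in [set: 'I_Nt]) (F k @^-1` C k))) =
    ((\prod_(i < n) P (X i @^-1` A i)) *
     (\prod_(j < Np) P (E j @^-1` B j)) *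
     (\prod_(k < Nt) P (F k @^-1` C k)))%E.

(* Main.v *)
(* Put w = algorithm output + noise, and let h(S,w) = exp(n kl(emp_S(w) || R(w))).
   Multiplying h by exp(-(|c + e|^2 - |e|^2) / (2 s^2)), c being the offset of the
   output from the prior mean, turns the law of the noise around the output into
   the law of the noise around the prior mean, which does not depend on S.  Hence
   Fubini reduces the expectation of the weighted h to that of h(S,w) for w fixed,
   which is at most 2 sqrt n, and Markov's inequality concludes.

   For w fixed and 0 < R(w) = p < 1, exp(n kl(q || p)) is a likelihood ratio.
   Bounding each of its factors by an affine function of the loss and expanding the
   product over subsets J of the sample gives independent factors of mean 1, and what
   remains is sum_k C(n,k) (k/n)^k (1-k/n)^(n-k).  By an identity of Abel and Cauchy
   this is sum_k n(n-1)...(n-k+1) / n^k, and k times the k-th term telescopes. *)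
Require Import Defs.
From HB Require Import structures.
From mathcomp Require Import all_boot all_order all_algebra.
From mathcomp Require Import ring lra zify.
From mathcomp Require Import all_classical all_reals all_analysis.
From mathcomp Require Import measurable_realfun.

Import Order.TTheory GRing.Theory Num.Theory.
Import numFieldNormedType.Exports.
Local Open Scope classical_set_scope.
Local Open Scope ring_scope.

(** * The normalizing sum of binomial maximum likelihoods *)

(** The [m]-th finite difference at 0 lowers the degree of a polynomial by [m]. In the induction,
    the absorption identity [(k+1) C(m+1,k+1) = (m+1) C(m,k)] lowers the order by one, and of the
    expanded [(k+1)^r] only the power [k^m] survives. *)
Lemma sum_finite_difference (R : comNzRingType) (m r : nat) : (r <= m)%N ->
  \sum_(k < m.+1) (-1) ^+ (m - k) * ('C(m, k) * k ^ r)%:R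
  = (if r == m then m`! else 0%N)%:R :> R.
Proof.
elim: m r => [|m IHm] [|r].
- by rewrite big_ord_recl big_ord0 /= expn0 mul1r addr0.
- by [].
(* For exponent 0 the sum is the binomial expansion of [(-1 + 1)^(m+1)]. *)
- move=> _ /=; have := @exprDn R (-1) 1 m.+1.
  rewrite addNr expr0n /= => H; rewrite [RHS]H.
  by apply: eq_bigr => k _; rewrite expr1n mulr1 expn0 muln1 mulr_natr.
rewrite ltnS => rm; rewrite big_ord_recl /= exp0n// muln0 mulr0 add0r.
transitivity (\sum_(k < m.+1) \sum_(i < r.+1)
   (m.+1 * 'C(r, i))%:R * ((-1) ^+ (m - k) * ('C(m, k) * k ^ i)%:R) : R).
  apply: eq_bigr => k _; rewrite /bump /= add1n subSS.
  have -> : ('C(m.+1, k.+1) * k.+1 ^ r.+1 = m.+1 * 'C(m, k) * k.+1 ^ r)%N.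
    by rewrite expnS mulnA [('C(_, _) * _)%N]mulnC -mul_bin_diag.
  rewrite natrM natrX -[k.+1%:R](@natr1 R k) addrC exprDn mulr_sumr mulr_sumr.
  apply: eq_bigr => i _; rewrite expr1n mul1r -[_ *+ 'C(r, i)]mulr_natr !natrM natrX; ring.
rewrite exchange_big /=.
rewrite (eq_bigr (fun i : 'I_r.+1 =>
    (m.+1 * 'C(r, i))%:R * (if i == m :> nat then m`! else 0%N)%:R)); last first.
  move=> i _; rewrite -mulr_sumr.
  have im : (i <= m)%N by rewrite -ltnS (leq_trans (ltn_ord i)).
  by rewrite IHm.
rewrite eqSS big_ord_recr /= big1 ?add0r.
  by rewrite binn muln1; case: eqP => _; rewrite ?factS ?natrM ?mulr0.
by move=> i _; rewrite ltn_eqF ?mulr0// (leq_trans (ltn_ord i)).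
Qed.

(** Both sides are the trinomial coefficient [n! / (j! k! (n-j-k)!)]. *)
Lemma mul_bin_subC (n j k : nat) : (j + k <= n)%N ->
  ('C(n, k) * 'C(n - k, j) = 'C(n, j) * 'C(n - j, k))%N.
Proof.
move=> jkn; have f0 : (0 < j`! * k`! * (n - j - k)`!)%N by rewrite !muln_gt0 !fact_gt0.
apply/eqP; rewrite -(eqn_pmul2r f0); apply/eqP.
have [kn jn] : (k <= n)%N /\ (j <= n)%N by lia.
have jnk : (j <= n - k)%N by lia.
have knj : (k <= n - j)%N by lia.
transitivity n`!.
  rewrite -(bin_fact kn) -(bin_fact jnk) subnAC; ring.
rewrite -(bin_fact jn) -(bin_fact knj); ring.
Qed.

(* Expanding (n - k)^(n - k), the sums over k become (n - j)-th differences of k^(n - j). *)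
Lemma abel_cauchy_sum (R : comNzRingType) (n : nat) :
  \sum_(k < n.+1) ('C(n, k) * k ^ k * (n - k) ^ (n - k))%:R
  = \sum_(j < n.+1) ('C(n, j) * n ^ j * (n - j)`!)%:R :> R.
Proof.
transitivity (\sum_(k < n.+1) \sum_(j < n.+1 | (j + k <= n)%N)
   ('C(n, j) * n ^ j)%:R *
   ((-1) ^+ (n - j - k) * ('C(n - j, k) * k ^ (n - j))%:R) : R).
  apply: eq_bigr => k _; have kn : (k <= n)%N by rewrite -ltnS.
  rewrite natrM [((n - k) ^ _)%:R]natrX natrB// addrC.
  rewrite exprDn mulr_sumr (big_ord_widen_cond n.+1 xpredT (fun j =>
    ('C(n, k) * k ^ k)%:R * ((- k%:R) ^+ (n - k - j) * n%:R ^+ j *+ 'C(n - k, j)) : R))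
    ?ltnS ?leq_subr//.
  apply: eq_big => [j|j /andP[_]]; first lia.
  rewrite ltnS => jn.
  have -> : (n - k - j = n - j - k)%N by lia.
  (* The powers [k^k] and [(-k)^(n-k-j)] merge into [k^(n-j)] up to sign, an exponent that no longer
     depends on [k]. *)
  have -> : (k ^ (n - j) = k ^ k * k ^ (n - j - k))%N by rewrite -expnD; congr expn; lia.
  have E : ('C(n, k) * 'C(n - k, j) = 'C(n, j) * 'C(n - j, k))%N.
    by apply: mul_bin_subC; lia.
  rewrite exprNn -mulr_natr !natrM !natrX.
  transitivity (('C(n, k) * 'C(n - k, j))%:R *
    (k%:R ^+ k * (-1) ^+ (n - j - k) * k%:R ^+ (n - j - k) * n%:R ^+ j) : R).
    rewrite natrM; ring.
  rewrite E natrM; ring.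
rewrite (exchange_big_dep xpredT)//=; apply: eq_bigr => j _.
have jn : (j <= n)%N by rewrite -ltnS.
rewrite -mulr_sumr [RHS]natrM; congr (_ * _).
transitivity (\sum_(i < (n - j).+1) (-1) ^+ (n - j - i) * ('C(n - j, i) * i ^ (n - j))%:R : R).
  rewrite [RHS](big_ord_widen_cond n.+1 xpredT (fun i =>
    (-1) ^+ (n - j - i) * ('C(n - j, i) * i ^ (n - j))%:R : R))
    ?ltnS ?leq_subr//.
  by apply: eq_bigl => i; lia.
by rewrite sum_finite_difference// eqxx.
Qed.

(** For positive [n], the probability that [k] uniform draws from [n] values are pairwise distinct;
    it vanishes for [k > n]. *)
Definition birthday (R : fieldType) (n k : nat) : R := (n ^_ k)%:R / n%:R ^+ k.

(** The first repetition occurs at draw [k+1] with probability [k/n] times the probability that the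
    first [k] draws are distinct. *)
Lemma birthday_step (R : numFieldType) n k : (0 < n)%N ->
  k%:R * birthday R n k = n%:R * (birthday R n k - birthday R n k.+1).
Proof.
move=> n0; have nR : n%:R != 0 :> R by rewrite pnatr_eq0 -lt0n.
rewrite /birthday ffactnSr natrM exprS invfM.
case: (leqP k n) => kn; last by rewrite ffact_small// !mul0r !(mulr0, subr0).
rewrite natrB//; field; by rewrite nR expf_neq0.
Qed.

Lemma birthday_ge0 (R : numFieldType) n k : 0 <= birthday R n k.
Proof. by rewrite divr_ge0// exprn_ge0. Qed.

Lemma birthday_decr (R : numFieldType) n k m : (0 < n)%N -> (k <= m)%N ->
  birthday R n m <= birthday R n k.
Proof.
move=> n0 /subnK <-; elim: (m - k)%N => [//|i IH].
rewrite addSn (le_trans _ IH)// -subr_ge0.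
by rewrite -(pmulr_rge0 (x := n%:R)) ?ltr0n// -birthday_step// mulr_ge0// birthday_ge0.
Qed.

(* From m on, each term is at most k / m times itself, and birthday_step telescopes. *)
Lemma birthday_sum_le (R : numFieldType) n m N : (0 < n)%N -> (0 < m)%N ->
  \sum_(k < N) birthday R n k <= m%:R + n%:R / m%:R * birthday R n m.
Proof.
move=> n0 m0; have b0 := birthday_ge0 R n.
have mR : 0 < m%:R :> R by rewrite ltr0n.
have b1 k : birthday R n k <= 1.
  by rewrite (le_trans (birthday_decr R n 0 k n0 _))// /birthday ffactn0 expr0 divr1.
suff H i : \sum_(k < m + i) birthday R n k <=
    m%:R + n%:R / m%:R * (birthday R n m - birthday R n (m + i)).
  apply: (@le_trans _ _ (\sum_(k < m + N) birthday R n k)).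
    rewrite -!(big_mkord xpredT) [leRHS](@big_cat_nat _ _ _ N)//= ?leq_addl//.
    by rewrite lerDl sumr_ge0.
  apply: le_trans (H N) _; rewrite lerD2l ler_wpM2l ?divr_ge0// lerBlDr.
  by rewrite lerDl.
elim: i => [|i IH].
  rewrite addn0 subrr mulr0 addr0; apply: (@le_trans _ _ (\sum_(k < m) 1)).
    exact: ler_sum.
  by rewrite sumr_const card_ord.
rewrite addnS big_ord_recr /=; apply: le_trans (lerD IH (lexx _)) _.
rewrite -addrA lerD2l -lerBrDl -mulrBr.
rewrite [X in _ * X](_ : _ = birthday R n (m + i) - birthday R n (m + i).+1); last by ring.
rewrite mulrAC -birthday_step// ler_pdivlMr// mulrC ler_wpM2r ?b0// ler_nat; exact: leq_addr.
Qed.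

(** A cut near [sqrt n] balances the two terms of [birthday_sum_le]. Bounding the last factor by
    [birthday R n 2 = 1 - 1/n] rather than by 1 absorbs the rounding of [sqrt n] to an integer. *)
Lemma birthday_sum_le_sqrt (R : realType) n N : (0 < n)%N ->
  \sum_(k < N) birthday R n k <= 2 * Num.sqrt n%:R.
Proof.
move=> n0; set r := Num.sqrt n%:R.
have r0 : 0 <= r by exact: sqrtr_ge0.
have rn : n%:R = r ^+ 2 by rewrite sqr_sqrtr.
have r1 : 1 <= r by rewrite -(ler_pXn2r (n := 2))// ?nnegrE// -rn expr1n ler1n.
(* Cutting at m.+1 gives the bound m.+1 + (n - 1) / m.+1, and |m.+1 - sqrt n| <= 1. *)
have /andP[m1 m2] := truncn_itv r0; set m := Num.truncn r in m1 m2.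
have m_gt0 : (0 < m)%N by rewrite -ltnS -(ltr_nat R) (le_lt_trans r1).
have b2 : birthday R n 2 = 1 - n%:R^-1.
  rewrite /birthday ffactnS ffactn1 natrM -subn1 natrB//; field.
  by rewrite pnatr_eq0 -lt0n.
apply: (le_trans (birthday_sum_le R n m.+1 N n0 _)) => //.
have nR : 0 < n%:R :> R by rewrite ltr0n.
have mR : 0 < m.+1%:R :> R by rewrite ltr0n.
apply: (@le_trans _ _ (m.+1%:R + n%:R / m.+1%:R * (1 - n%:R^-1))).
  by rewrite lerD2l -b2 ler_wpM2l ?divr_ge0// birthday_decr.
have -> : m.+1%:R + n%:R / m.+1%:R * (1 - n%:R^-1) =
    (m.+1%:R ^+ 2 + (n%:R - 1)) / m.+1%:R :> R.
  by field; rewrite !gt_eqF// -natr1 in mR *.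
rewrite ler_pdivrMr// rn; rewrite -natr1 in m2 mR *; nra.
Qed.

(** Once [n^n] is factored out this is the left side of [abel_cauchy_sum]. Reversing the order of
    the right side turns [C(n,j) n^j (n-j)! / n^n] into [birthday R n (n-j)]. *)
Lemma sum_binomial_ml (R : realType) n : (0 < n)%N ->
  \sum_(k < n.+1) 'C(n, k)%:R * ((k%:R / n%:R) ^+ k * (1 - k%:R / n%:R) ^+ (n - k))
  <= 2 * Num.sqrt n%:R :> R.
Proof.
move=> n0; have nR : n%:R != 0 :> R by rewrite pnatr_eq0 -lt0n.
have En (k : nat) : (k <= n)%N -> n%:R ^- n = n%:R ^- k * n%:R ^- (n - k) :> R.
  by move=> kn; rewrite -invfM -exprD subnKC.
apply: le_trans (birthday_sum_le_sqrt R n n.+1 n0).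
rewrite le_eqVlt; apply/orP; left; apply/eqP.
transitivity (n%:R ^- n * \sum_(k < n.+1) ('C(n, k) * k ^ k * (n - k) ^ (n - k))%:R : R).
  rewrite mulr_sumr; apply: eq_bigr => k _; have kn : (k <= n)%N by rewrite -ltnS.
  have -> : 1 - k%:R / n%:R = (n - k)%:R / n%:R :> R by rewrite natrB//; field.
  rewrite !exprMn !natrM !natrX !exprVn (En _ kn); ring.
rewrite abel_cauchy_sum mulr_sumr (reindex_inj rev_ord_inj) /=.
apply: eq_bigr => k _; have kn : (k <= n)%N by rewrite -ltnS.
rewrite /birthday subSS subKn// bin_sub// mulnAC bin_ffact natrM natrX.
rewrite (En _ kn). field.
by rewrite !expf_neq0.
Qed.

(** * Likelihood ratios bounded by sums over subsets of the sample *)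

Lemma binomial_likelihood_le (R : realType) (n k : nat) (q : R) :
  (k <= n)%N -> 0 <= q <= 1 ->
  q ^+ k * (1 - q) ^+ (n - k)
  <= (k%:R / n%:R) ^+ k * (1 - k%:R / n%:R) ^+ (n - k).
Proof.
move=> kn /andP[q0 q1].
(* This is [a/b <= expR (a/b - 1)] raised to the power [j]. It serves twice, with [b = k/n] and with
   [b = 1 - k/n], and the two exponents cancel. *)
have pow_le (a b : R) (j : nat) : 0 <= a -> 0 < b -> j%:R = b * n%:R ->
    a ^+ j <= b ^+ j * expR (n%:R * a - j%:R).
  move=> a0 b0 jb.
  have -> : n%:R * a - j%:R = (a / b - 1) * j%:R.
    by rewrite jb; field; rewrite gt_eqF.
  rewrite expRM_natr -exprMn lerXn2r ?nnegrE// ?mulr_ge0 ?expR_ge0// ?(ltW b0)//.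
  by rewrite mulrC -ler_pdivrMr// -[leLHS](subrK 1) addrC expR_ge1Dx.
(* For [k = 0] or [k = n] one of the two frequencies is 0, which [pow_le] excludes. *)
have [->|k0] := posnP k.
  by rewrite !expr0 mul0r subr0 expr1n !mul1r exprn_ile1// ?subr_ge0// gerBl.
have n0 : 0 < n%:R :> R by rewrite ltr0n (leq_trans k0).
have [->|nk] := eqVneq k n.
  by rewrite subnn !expr0 !mulr1 divff ?gt_eqF// expr1n exprn_ile1.
have kltn : (k < n)%N by rewrite ltn_neqAle nk.
have k1 : 0 < 1 - k%:R / n%:R :> R by rewrite subr_gt0 ltr_pdivrMr// mul1r ltr_nat.
apply: (@le_trans _ _ (((k%:R / n%:R) ^+ k * expR (n%:R * q - k%:R)) *
  ((1 - k%:R / n%:R) ^+ (n - k) * expR (n%:R * (1 - q) - (n - k)%:R)))).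
  apply: ler_pM; rewrite ?exprn_ge0 ?subr_ge0//; apply: pow_le => //.
  - by rewrite divr_gt0// ltr0n.
  - by field; rewrite gt_eqF.
  - by rewrite subr_ge0.
  - by rewrite natrB//; field; rewrite gt_eqF.
have e0 : n%:R * q - k%:R + (n%:R * (1 - q) - (n - k)%:R) = 0 by rewrite natrB//; ring.
by rewrite mulrACA -expRD e0 expR0 mulr1.
Qed.

(** The tangent at the mean [m] lies below the exponential, and the weighted average of its values
    at [a] and [b] is [expR m]. *)
Lemma expR_convex (R : realType) (t a b : R) : 0 <= t <= 1 ->
  expR (t * a + (1 - t) * b) <= t * expR a + (1 - t) * expR b.
Proof.
move=> /andP[t0 t1]; set m := t * a + (1 - t) * b.
have tangent c : expR m * (1 + (c - m)) <= expR c.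
  rewrite -[leRHS](_ : expR m * expR (c - m) = _); last by rewrite -expRD addrC subrK.
  by rewrite ler_wpM2l ?expR_ge0 ?expR_ge1Dx.
apply: le_trans (lerD (ler_wpM2l t0 (tangent a)) (ler_wpM2l _ (tangent b))); last first.
  by rewrite subr_ge0.
by rewrite le_eqVlt; apply/orP; left; apply/eqP; rewrite /m; ring.
Qed.

(** The exponent is a sum over the sample, so convexity bounds each factor by an affine function of
    [x i]. In the expanded product the coefficient [q^#|J| (1-q)^(n-#|J|)] still depends on the
    sample through [q]; replacing it by its maximum over [q] makes it a constant that can leave an
    expectation. *)
Lemma expR_kl_le (R : realType) (n : nat) (x : 'I_n -> R) (p q : R) :
  (0 < n)%N -> (forall i, 0 <= x i <= 1) -> 0 < p < 1 ->
  q = n%:R^-1 * \sum_(i < n) x i ->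
  expR (n%:R * (q * ln (q / p) + (1 - q) * ln ((1 - q) / (1 - p)))) <=
  \sum_(J : {set 'I_n})
    (#|J|%:R / n%:R) ^+ #|J| * (1 - #|J|%:R / n%:R) ^+ (n - #|J|) *
    \prod_(i < n) (if i \in J then x i / p else (1 - x i) / (1 - p)).
Proof.
move=> n0 x01 /andP[p0 p1] qE.
have nR : 0 < n%:R :> R by rewrite ltr0n.
have sumx : \sum_(i < n) x i = n%:R * q by rewrite qE mulrA divff ?gt_eqF// mul1r.
have sum1x : \sum_(i < n) (1 - x i) = n%:R * (1 - q).
  by rewrite sumrB sumx sumr_const card_ord; ring.
have xge i : 0 <= x i by case/andP: (x01 i).
have xle i : 0 <= 1 - x i by rewrite subr_ge0; case/andP: (x01 i).
have q0 : 0 <= q by rewrite -(pmulr_rge0 _ nR) -sumx sumr_ge0.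
have q1 : 0 <= 1 - q by rewrite -(pmulr_rge0 _ nR) -sum1x sumr_ge0.
have p1' : 0 < 1 - p by rewrite subr_gt0.
set A := ln (q / p); set B := ln ((1 - q) / (1 - p)).
(* For q = 0 or q = 1 the logarithms are junk, but then every x i is q. *)
have factor i : expR (x i * A + (1 - x i) * B) <=
    x i * (q / p) + (1 - x i) * ((1 - q) / (1 - p)).
  have [q00|qn0] := eqVneq q 0.
    have xi0 : x i = 0.
      by apply: (psumr_eq0P (P := xpredT) (F := x)) => //; rewrite sumx q00 mulr0.
    by rewrite xi0 !mul0r !add0r subr0 !mul1r /B q00 subr0 lnK ?posrE ?divr_gt0.
  have [q11|qn1] := eqVneq (1 - q) 0.
    have xi1 : 1 - x i = 0.
      by apply: (psumr_eq0P (P := xpredT) (F := fun i => 1 - x i)) => //;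
        rewrite sum1x q11 mulr0.
    rewrite xi1 !mul0r !addr0 (_ : x i = 1) ?mul1r; last by lra.
    by rewrite /A lnK// posrE divr_gt0// lt0r qn0.
  apply: le_trans (expR_convex _ _ _ _ (x01 i)) _.
  by rewrite /A /B !lnK// posrE divr_gt0// lt0r ?qn0 ?qn1.
have -> : n%:R * (q * A + (1 - q) * B) = \sum_(i < n) (x i * A + (1 - x i) * B).
  by rewrite big_split /= -!mulr_suml sumx sum1x; ring.
rewrite expR_sum.
apply: (@le_trans _ _ (\prod_(i < n) (x i / p * q + (1 - x i) / (1 - p) * (1 - q)))).
  apply: ler_prod => i _; rewrite expR_ge0 /=; apply: le_trans (factor i) _.
  by rewrite !mulrA ![_ / _ * _]mulrAC.
(* [J] is the set of indices at which the first summand of the factor is chosen. *)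
rewrite bigA_distr; apply: ler_sum => J _.
have -> : \prod_(i < n) (if i \in J then x i / p * q else (1 - x i) / (1 - p) * (1 - q))
  = q ^+ #|J| * (1 - q) ^+ (n - #|J|) *
    \prod_(i < n) (if i \in J then x i / p else (1 - x i) / (1 - p)).
  have nJ : (n - #|J| = #|~: J|)%N by rewrite [RHS]cardsCs finset.setCK card_ord.
  rewrite nJ -!prodr_const (big_mkcond (mem J)) (big_mkcond (mem (~: J))) -!big_split /=.
  by apply: eq_bigr => i _; rewrite inE; case: (i \in J) => /=; ring.
apply: ler_wpM2r.
  by apply: prodr_ge0 => i _; case: ifP => _; rewrite divr_ge0// ltW.
apply: binomial_likelihood_le; last by lra.
by rewrite -[leqRHS]card_ord max_card.
Qed.

(** Grouping the subsets by cardinality produces the binomial coefficients of [sum_binomial_ml]. *)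
Lemma sum_set_likelihood (R : realType) n : (0 < n)%N ->
  \sum_(J : {set 'I_n}) (#|J|%:R / n%:R) ^+ #|J| * (1 - #|J|%:R / n%:R) ^+ (n - #|J|)
  <= 2 * Num.sqrt n%:R :> R.
Proof.
move=> n0; apply: le_trans (sum_binomial_ml R n n0).
rewrite le_eqVlt; apply/orP; left; apply/eqP.
have cardJ (J : {set 'I_n}) : (#|J| < n.+1)%N.
  by rewrite ltnS -[leqRHS]card_ord max_card.
rewrite (partition_big (fun J => Ordinal (cardJ J)) xpredT)//=.
apply: eq_bigr => k _.
rewrite (eq_bigr (fun=> (k%:R / n%:R) ^+ k * (1 - k%:R / n%:R) ^+ (n - k))); last first.
  by move=> J /eqP <-.
rewrite sumr_const -[LHS]mulr_natl; congr (_ * _).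
have -> : 'C(n, k) = #|[set J : {set 'I_n} | #|J| == k :> nat]|%SET.
  by rewrite card_draws card_ord.
by congr _%:R; apply: eq_card => J; rewrite !inE.
Qed.

(** * Product probabilities on tuples *)

Section tcons.
Context d (T : measurableType d) (n : nat).
(** Uncurried, and declared measurable below, so that [distribution] can push a product law along
    it. *)
Definition tcons (z : T * n.-tuple T) : n.+1.-tuple T := [tuple of z.1 :: z.2].
Lemma measurable_tcons : measurable_fun [set: T * n.-tuple T] tcons.
Proof. by apply: measurable_cons. Qed.
HB.instance Definition _ := isMeasurableFun.Build _ _ _ _ tcons measurable_tcons.
End tcons.

Section iid_prob.
Context d (T : measurableType d) (R : realType) (m : probability T R).
Local Open Scope ereal_scope.

(** The [n]-th power of [m], built one coordinate at a time so that Tonelli's theorem peels off the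
    head of the tuple. *)
Fixpoint iid_prob (n : nat) : probability (n.-tuple T) R :=
  match n with
  | 0 => \d_[tuple]
  | k.+1 => distribution (m \x iid_prob k) (@tcons _ T k)
  end.

Lemma integral_iid_probS n (F : n.+1.-tuple T -> \bar R) :
  measurable_fun [set: n.+1.-tuple T] F -> (forall t, 0 <= F t) ->
  \int[iid_prob n.+1]_t F t =
  \int[m]_x \int[iid_prob n]_t F [tuple of x :: t].
Proof.
move=> mF F0; rewrite /= ge0_integral_distribution//.
rewrite fubini_tonelli1//.
  by apply: measurableT_comp.
by move=> z /=; exact: F0.
Qed.

Lemma measurable_tuple_prod n (f : 'I_n -> T -> \bar R) :
  (forall i, measurable_fun setT (f i)) ->
  measurable_fun setT (fun t : n.-tuple T => \prod_(i < n) f i (tnth t i)).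
Proof.
move=> mf; elim: (index_enum _) => [|i s IH].
  by under eq_fun do rewrite big_nil; exact: measurable_cst.
under eq_fun do rewrite big_cons.
apply: emeasurable_funM => //; apply: measurableT_comp (mf i) _.
exact: measurable_tnth.
Qed.

(** Once the head is peeled off, its factor is constant in the integral over the tail, and the tail
    integral is constant in the head. *)
Lemma integral_iid_prob_prod n (f : 'I_n -> T -> \bar R) :
  (forall i, measurable_fun setT (f i)) -> (forall i x, 0 <= f i x) ->
  \int[iid_prob n]_t \prod_(i < n) f i (tnth t i) =
  \prod_(i < n) \int[m]_x f i x.
Proof.
elim: n f => [|n IH] f mf f0.
  under eq_integral do rewrite big_ord0.
  rewrite big_ord0 integral_cst// mul1e.
  exact: (probability_setT (iid_prob 0)).
rewrite integral_iid_probS; last 2 first.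
- exact: measurable_tuple_prod.
- by move=> t; apply: prode_ge0.
have E x : \int[iid_prob n]_t \prod_(i < n.+1) f i (tnth [tuple of x :: t] i) =
    f ord0 x * \prod_(i < n) \int[m]_y f (lift ord0 i) y.
  rewrite -IH// -ge0_integralZl//.
  - apply: eq_integral => t _; rewrite big_ord_recl; congr (_ * _).
    by apply: eq_bigr => i _; rewrite tnthS.
  - by apply: (measurable_tuple_prod n (fun i => f (lift ord0 i))) => i; exact: mf.
  - by move=> t _; apply: prode_ge0.
under eq_integral => x _ do rewrite E.
rewrite ge0_integralZr//; first by rewrite big_ord_recl.
by apply: prode_ge0 => i _; apply: integral_ge0.
Qed.
End iid_prob.

Definition rect (T : Type) (n : nat) (A : 'I_n -> set T) : set (n.-tuple T) :=
  [set t | forall i, A i (tnth t i)].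

Lemma measurable_rect d (T : measurableType d) n (A : 'I_n -> set T) :
  (forall i, measurable (A i)) -> measurable (rect T n A).
Proof.
move=> mA; rewrite [X in measurable X](_ : _ =
  \bigcap_(i in [set: 'I_n]) ((fun t : n.-tuple T => tnth t i) @^-1` A i)).
  apply: fin_bigcap_measurable => // i _; rewrite -[X in measurable X]setTI.
  exact: measurable_tnth.
by apply/seteqP; split => t /= At i; [move=> _; exact: At|exact: At].
Qed.

(** The indicator of a rectangle is the product of the indicators of its sides. *)
Lemma iid_prob_rect d (T : measurableType d) (R : realType) (m : probability T R)
    n (A : 'I_n -> set T) : (forall i, measurable (A i)) ->
  iid_prob _ _ _ m n (rect T n A) = (\prod_(i < n) m (A i))%E.
Proof.
move=> mA; have mR := measurable_rect _ T n A mA.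
rewrite -[X in iid_prob _ _ _ _ _ X]setIT -integral_indic//.
rewrite (eq_integral (fun t => \prod_(i < n) (\1_(A i) (tnth t i))%:E)%E).
  rewrite (integral_iid_prob_prod _ _ _ _ n (fun i x => (\1_(A i) x)%:E))//.
    by apply: eq_bigr => i _; rewrite integral_indic// setIT.
  by move=> i; apply/measurable_EFinP; exact: measurable_indic.
move=> t _; rewrite prodEFin; congr EFin; rewrite indicE.
have [/set_mem At|] := boolP (t \in rect T n A).
  by rewrite big1// => i _; rewrite indicE mem_set.
move=> nAt; have /existsNP[i nAi] : ~ forall i, A i (tnth t i).
  by move=> At; move/negP: nAt; apply; rewrite inE.
by rewrite (bigD1 i)//= indicE memNset// mul0r.
Qed.

Section boxes.
Context d1 d2 d3 (T1 : measurableType d1) (T2 : measurableType d2)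
  (T3 : measurableType d3) (R : realType) (n p q : nat).
Let Z := (n.-tuple T1 * (p.-tuple T2 * q.-tuple T3))%type.

(** These are the sets on which mutual independence prescribes the joint law of the sample and the
    two noises. *)
Definition box : set (set Z) := [set U | exists A B C,
  [/\ forall i, measurable (A i), forall i, measurable (B i),
      forall i, measurable (C i) &
      U = rect T1 n A `*` (rect T2 p B `*` rect T3 q C)]].

Lemma measurable_box : @measurable _ Z = <<s box >>.
Proof.
apply/seteqP; split; last first.
  apply: smallest_sub; first exact: sigma_algebra_measurable.
  move=> _ [A [B [C [mA mB mC ->]]]].
  by apply: measurableX; [|apply: measurableX]; exact: measurable_rect.
(* It suffices that the identity from the sigma-algebra of boxes is measurable,
   which can be checked one coordinate at a time. *)
suff H : measurable_fun [set: g_sigma_algebraType box] (id : g_sigma_algebraType box -> Z).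
  by move=> U mU; have := H measurableT U mU; rewrite setTI.
(* A condition on a single coordinate is a box whose other sides are the whole space. *)
have mif (d : measure_display) (T : measurableType d) k (i : 'I_k) (U : set T) :
    measurable U -> forall j, measurable (if j == i then U else setT).
  by move=> mU j; case: ifP.
have rectif (T : Type) k (i : 'I_k) (U : set T) (t : k.-tuple T) :
    rect T k (fun j => if j == i then U else setT) t = U (tnth t i).
  apply/propext; split=> [/(_ i)|Ut j]; first by rewrite eqxx.
  by case: eqP => [->|].
have rectT (T : Type) k (t : k.-tuple T) : rect T k (fun=> setT) t = True.
  by apply/propext; split.
apply/measurable_fun_pairP; split; [|apply/measurable_fun_pairP; split];
  apply/measurable_fun_tnthP => i _ U mU; rewrite setTI; apply: sub_sigma_algebra.
- exists (fun j => if j == i then U else setT), (fun=> setT), (fun=> setT).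
  split; [exact: mif|by []|by []|].
  by apply/seteqP; split=> z /=; rewrite rectif !rectT; tauto.
- exists (fun=> setT), (fun j => if j == i then U else setT), (fun=> setT).
  split; [by []|exact: mif|by []|].
  by apply/seteqP; split=> z /=; rewrite rectif !rectT; tauto.
- exists (fun=> setT), (fun=> setT), (fun j => if j == i then U else setT).
  split; [by []|by []|exact: mif|].
  by apply/seteqP; split=> z /=; rewrite rectif !rectT; tauto.
Qed.

Lemma boxI : setI_closed box.
Proof.
move=> _ _ [A [B [C [mA mB mC ->]]]] [A' [B' [C' [mA' mB' mC' ->]]]].
exists (fun i => A i `&` A' i), (fun i => B i `&` B' i), (fun i => C i `&` C' i).
split; try by move=> i; exact: measurableI.
have rectI (T : Type) k (U V : 'I_k -> set T) :
    rect T k (fun i => U i `&` V i) = rect T k U `&` rect T k V.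
  apply/seteqP; split=> t; first by move=> UV; split=> i; have [] := UV i.
  by move=> [Ut Vt] i; split; [exact: Ut|exact: Vt].
by rewrite !rectI -!setXI.
Qed.

(** Boxes form a generating pi-system that contains the whole space, so Dynkin's uniqueness theorem
    applies to finite measures. *)
Lemma measure_unique_box (m1 m2 : {measure set Z -> \bar R}) :
  (forall U, box U -> m1 U = m2 U) -> (m1 setT < +oo)%E ->
  forall U, measurable U -> m1 U = m2 U.
Proof.
move=> m12 m1oo U mU; apply: (measure_unique box (fun=> setT)) => //.
- exact: measurable_box.
- exact: boxI.
- move=> _; exists (fun=> setT), (fun=> setT), (fun=> setT).
  by split=> //; apply/seteqP; split=> z.
- by apply/seteqP; split=> // z _; exists 0%N.
Qed.
End boxes.

Lemma measurable_tuple_of d d' (Y : measurableType d) (T : measurableType d') n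
    (f : 'I_n -> Y -> T) : (forall i, measurable_fun setT (f i)) ->
  measurable_fun setT (fun y => [tuple f i y | i < n]).
Proof.
move=> mf; apply/measurable_fun_tnthP => i.
by rewrite [X in measurable_fun _ X](_ : _ = f i)//; apply/funext => y /=; rewrite tnth_mktuple.
Qed.

(** Independence and the marginal laws make the joint law agree with the product law on boxes, hence
    everywhere. Tonelli's theorem then gives the iterated integral, and the abstract space [Omega]
    disappears. *)
Lemma integral_sample_noise (R : realType) (d : measure_display) (T : measurableType d)
  (D : probability T R) (NP NT : probability R R)
  (dO : measure_display) (Omega : measurableType dO) (P : probability Omega R)
  (n Np Nt : nat)
  (X : 'I_n -> Omega -> T) (ep : 'I_Np -> Omega -> R) (et : 'I_Nt -> Omega -> R)
  (X_meas : forall i, measurable_fun setT (X i))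
  (ep_meas : forall j, measurable_fun setT (ep j))
  (et_meas : forall k, measurable_fun setT (et k))
  (X_law : forall i A, measurable A -> P (X i @^-1` A) = D A)
  (ep_law : forall j B, measurable B -> P (ep j @^-1` B) = NP B)
  (et_law : forall k C, measurable C -> P (et k @^-1` C) = NT C)
  (indep : mutually_independent P X ep et)
  (F : n.-tuple T * (Np.-tuple R * Nt.-tuple R) -> \bar R) :
  measurable_fun setT F -> (forall z, 0 <= F z)%E ->
  (\int[P]_w F ([tuple X i w | i < n], ([tuple ep j w | j < Np], [tuple et k w | k < Nt])) =
   \int[iid_prob _ _ _ D n]_s \int[iid_prob _ _ _ NP Np]_e \int[iid_prob _ _ _ NT Nt]_f
     F (s, (e, f)))%E.
Proof.
move=> mF F0.
pose Phi w := ([tuple X i w | i < n], ([tuple ep j w | j < Np], [tuple et k w | k < Nt])).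
have mPhi : measurable_fun setT Phi.
  apply/measurable_fun_pairP; split.
    exact: measurable_tuple_of.
  apply/measurable_fun_pairP; split.
    exact: measurable_tuple_of.
  exact: measurable_tuple_of.
pose m23 : probability (Np.-tuple R * Nt.-tuple R)%type R :=
  (iid_prob _ _ _ NP Np \x iid_prob _ _ _ NT Nt)%E.
pose m2 : probability (n.-tuple T * (Np.-tuple R * Nt.-tuple R))%type R :=
  (iid_prob _ _ _ D n \x m23)%E.
transitivity (\int[m2]_z F z)%E; last first.
  rewrite (@fubini_tonelli1 _ _ _ _ R (iid_prob _ _ _ D n) m23 F mF F0).
  apply: eq_integral => s _.
  rewrite /fubini_F fubini_tonelli1//.
  exact: measurableT_comp.
pose Phi' : {mfun Omega >-> _} := mfun_Sub (mem_set mPhi).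
transitivity (\int[distribution P Phi']_z F z)%E.
  rewrite ge0_integral_distribution//.
apply: eq_measure_integral => U mU _.
apply: (measure_unique_box _ _ _ T R R R n Np Nt (distribution P Phi') m2).
- move=> _ [A [B [C [mA mB mC ->]]]].
  have m2E : m2 (rect T n A `*` (rect R Np B `*` rect R Nt C)) =
      (iid_prob _ _ _ D n (rect T n A) *
       (iid_prob _ _ _ NP Np (rect R Np B) * iid_prob _ _ _ NT Nt (rect R Nt C)))%E.
    have mR1 := measurable_rect _ _ _ _ mA; have mR2 := measurable_rect _ _ _ _ mB.
    have mR3 := measurable_rect _ _ _ _ mC.
    rewrite (_ : m2 _ = iid_prob _ _ _ D n (rect T n A) *
      m23 (rect R Np B `*` rect R Nt C))%E; last first.
      by apply: product_measure1E => //; exact: measurableX.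
    by congr (_ * _)%E; exact: product_measure1E.
  rewrite [RHS]m2E !iid_prob_rect// muleA.
  rewrite (eq_bigr (fun i => P (X i @^-1` A i))); last by move=> i _; rewrite X_law.
  rewrite [X in (_ * X * _)%E](eq_bigr (fun j => P (ep j @^-1` B j))); last first.
    by move=> j _; rewrite ep_law.
  rewrite [X in (_ * _ * X)%E](eq_bigr (fun k => P (et k @^-1` C k))); last first.
    by move=> k _; rewrite et_law.
  rewrite -indep//; congr (P _).
  have tupE (Y : Type) k (f : 'I_k -> Omega -> Y) (V : 'I_k -> set Y) :
      (fun w => [tuple f i w | i < k]) @^-1` rect Y k V =
      \bigcap_(i in [set: 'I_k]) (f i @^-1` V i).
    apply/seteqP; split=> w /= Vw i; first by move=> _; have := Vw i; rewrite tnth_mktuple.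
    by rewrite tnth_mktuple; exact: Vw.
  by rewrite -!tupE -setIA.
- by rewrite (le_lt_trans (probability_le1 _ _))// ltry.
- by [].
Qed.

(** * Gaussian shifts *)

Section integral_density.
Context d (T : measurableType d) (R : realType).
Variables (mu nu : {measure set T -> \bar R}) (g : T -> R).
Hypotheses (mg : measurable_fun setT g) (g0 : forall x, 0 <= g x).
Hypothesis nuE : forall A, measurable A -> nu A = (\int[mu]_(x in A) (g x)%:E)%E.
Local Open Scope ereal_scope.
Import HBNNSimple.

(** Monotone convergence on both sides reduces the claim to simple functions, and [nuE] settles it
    on each level set. *)
Lemma ge0_integral_density (f : T -> \bar R) :
  measurable_fun setT f -> (forall x, 0 <= f x) ->
  \int[nu]_x f x = \int[mu]_x (f x * (g x)%:E).
Proof.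
move=> mf f0; pose h := nnsfun_approx measurableT mf.
have cvgh x : (EFin \o h ^~ x) n @[n --> \oo] --> f x.
  by apply: cvg_nnsfun_approx.
have ndh x : nondecreasing_seq (h ^~ x).
  by move=> a b ab; exact/lefP/nd_nnsfun_approx.
transitivity (limn (fun n => \int[nu]_x (h n x)%:E)).
  rewrite -monotone_convergence//.
  - by apply: eq_integral => x _; apply/esym/cvg_lim => //; exact: cvgh.
  - by move=> n; exact/measurable_EFinP.
  - by move=> n x _; rewrite lee_fin.
  - by move=> x _ a b ab; rewrite lee_fin; exact: ndh.
transitivity (limn (fun n => \int[mu]_x ((h n x)%:E * (g x)%:E))); last first.
  rewrite -monotone_convergence//.
  - apply: eq_integral => x _; apply/cvg_lim => //.
    by apply: cvgeZr => //; exact: cvgh.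
  - by move=> n; apply: emeasurable_funM; exact/measurable_EFinP.
  - by move=> n x _; rewrite mule_ge0// lee_fin.
  - by move=> x _ a b ab; rewrite lee_wpmul2r ?lee_fin//; exact: ndh.
congr (limn _); apply/funext => n.
transitivity (\sum_(r \in range (h n)) r%:E * nu (h n @^-1` [set r])).
  by rewrite integralT_nnsfun sintegralE.
transitivity (\int[mu]_x (\sum_(r \in range (h n))
    (r * \1_(h n @^-1` [set r]) x)%:E * (g x)%:E)); last first.
  apply: eq_integral => x _; rewrite fimfunE -fsumEFin// ge0_mule_fsuml//.
  by move=> r; exact: nnfun_muleindic_ge0.
rewrite ge0_integral_fsum//; last 2 first.
- move=> r; apply: emeasurable_funM; last exact/measurable_EFinP.
  by apply/measurable_EFinP/measurable_funM.
- by move=> r x _; rewrite mule_ge0 ?lee_fin//; exact: nnfun_muleindic_ge0.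
apply: eq_fsbigr => r; rewrite inE => -[x _ <-].
have mh : measurable (h n @^-1` [set h n x]) by exact: measurable_sfunP.
have mgh : measurable_fun setT ((EFin \o g) \_ (h n @^-1` [set h n x])).
  by apply/(measurable_restrictT _ mh)/measurable_funTS/measurable_EFinP.
rewrite nuE// integral_mkcond -ge0_integralZl//; last 2 first.
- by move=> y _; apply: erestrict_ge0 => z _; rewrite lee_fin.
- by rewrite lee_fin.
apply: eq_integral => y _; rewrite EFinM -muleA; congr (_ * _).
by rewrite epatch_indic muleC.
Qed.
End integral_density.

(** Lebesgue measure is determined by its values on half-open intervals, and translation preserves
    their length. *)
Lemma pushforward_lebesgue_shift (R : realType) (c : R) (A : set R) :
  measurable A ->
  pushforward lebesgue_measure (fun x : measurableTypeR R => c + x : measurableTypeR R) A =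
  lebesgue_measure A.
Proof.
move=> mA; apply/esym/lebesgue_measure_unique => //=; first exact: measurable_funD.
move=> _ _ [[a b]] _ <-.
rewrite /pushforward (_ : _ @^-1` _ = `]a - c, b - c]%classic).
  rewrite !lebesgue_measure_itv/= !lte_fin ltrD2r -!EFinD.
  by rewrite (_ : b - c - (a - c) = b - a)//; ring.
by apply/seteqP; split=> x /=; rewrite !in_itv/= ltrBlDl lerBrDl.
Qed.

(** The weight times the normal density at [x] is the normal density at [c + x], so the claim is
    translation invariance of Lebesgue measure. *)
Lemma integral_normal_shift (R : realType) (s c : R) (f : R -> \bar R) :
  s != 0 -> measurable_fun setT f -> (forall x, 0 <= f x)%E ->
  (\int[normal_prob 0 s]_x
    (f (c + x)%R * (expR (- (((c + x) ^+ 2 - x ^+ 2) / (2 * s ^+ 2))))%:E) =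
   \int[normal_prob 0 s]_x f x)%E.
Proof.
move=> s0 mf f0.
pose tr : measurableTypeR R -> measurableTypeR R := fun x => c + x.
have mc : measurable_fun [set: measurableTypeR R] tr.
  exact: measurable_funD.
have densE (h : R -> \bar R) : measurable_fun setT h -> (forall x, 0 <= h x)%E ->
    (\int[normal_prob 0 s]_x h x = \int[lebesgue_measure]_x (h x * (normal_pdf 0 s x)%:E))%E.
  move=> mh h0; apply: ge0_integral_density => //.
  - exact: measurable_normal_pdf.
  - by move=> x; exact: normal_pdf_ge0.
rewrite !densE//; last 2 first.
- apply: emeasurable_funM; first exact: measurableT_comp.
  apply/measurable_EFinP/measurableT_comp => //; apply: measurableT_comp => //.
  apply: measurable_funM => //; apply: measurable_funB; apply: measurable_funX => //.
- by move=> x; rewrite mule_ge0// lee_fin expR_ge0.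
pose F x := (f x * (normal_pdf 0 s x)%:E)%E.
have mF : measurable_fun setT F.
  by apply: emeasurable_funM => //; apply/measurable_EFinP; exact: measurable_normal_pdf.
transitivity (\int[lebesgue_measure]_x F (c + x)%R)%E.
  apply: eq_integral => x _; rewrite /F -muleA; congr (_ * _)%E.
  rewrite -EFinM; congr EFin.
  rewrite !normal_pdfE//= mulrCA; congr (_ * _).
  rewrite /normal_fun !subr0 -expRD; congr expR; rewrite -mulr_natr; field.
  by rewrite s0.
transitivity (\int[pushforward lebesgue_measure tr]_x F x)%E.
  rewrite ge0_integral_pushforward//.
  by move=> x _; rewrite mule_ge0// lee_fin normal_pdf_ge0.
apply: eq_measure_integral => A mA _; exact: pushforward_lebesgue_shift.
Qed.

Lemma measurable_coord d (Y : measurableType d) (R : realType) N (u : Y -> N.-tuple R) i :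
  measurable_fun setT u -> measurable_fun setT (fun y => tnth (u y) i).
Proof.
move=> mu; apply: (measurableT_comp (f := fun t : N.-tuple R => tnth t i)) mu.
exact: measurable_tnth.
Qed.

Lemma measurable_vadd d (Y : measurableType d) (R : realType) N (u v : Y -> N.-tuple R) :
  measurable_fun setT u -> measurable_fun setT v ->
  measurable_fun setT (fun y => vadd (u y) (v y)).
Proof.
by move=> mu mv; apply: measurable_tuple_of => i; apply: measurable_funD; exact: measurable_coord.
Qed.

Lemma measurable_vsub d (Y : measurableType d) (R : realType) N (u v : Y -> N.-tuple R) :
  measurable_fun setT u -> measurable_fun setT v ->
  measurable_fun setT (fun y => vsub (u y) (v y)).
Proof.
by move=> mu mv; apply: measurable_tuple_of => i; apply: measurable_funB; exact: measurable_coord.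
Qed.

Lemma measurable_sqnorm d (Y : measurableType d) (R : realType) N (u : Y -> N.-tuple R) :
  measurable_fun setT u -> measurable_fun setT (fun y => sqnorm (u y)).
Proof.
move=> mu; apply: measurable_sum => i; apply: measurable_funX.
exact: measurable_coord.
Qed.

(* normal_prob is declared on measurableTypeR R, whose display is not that of R. *)
Section gaussian.
Context (R : realType) (s : R).
Definition gaussian : set R -> \bar R := normal_prob 0 s.
HB.instance Definition _ := isMeasure.Build default_measure_display R R gaussian
  (measure0 (normal_prob 0 s)) (@measure_ge0 _ _ _ (normal_prob 0 s))
  (@measure_semi_sigma_additive _ _ _ (normal_prob 0 s)).
HB.instance Definition _ := @Measure_isProbability.Build _ _ _ gaussian
  (probability_setT (normal_prob 0 s)).

Lemma ge0_integral_gaussian (f : R -> \bar R) :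
  measurable_fun setT f -> (forall x, 0 <= f x)%E ->
  (\int[gaussian]_x f x = \int[normal_prob 0 s]_x f x)%E.
Proof.
move=> mf f0; have mid : measurable_fun [set: measurableTypeR R] (id : measurableTypeR R -> R).
  by move=> _ U mU; rewrite setTI.
have := @ge0_integral_pushforward _ _ (measurableTypeR R) R R _ mid
  (normal_prob 0 s) setT f measurableT mf.
by rewrite preimage_setT => <-.
Qed.
End gaussian.

(* Density of N(0, s^2 I) at c + e relative to e. *)
Definition normal_shift_weight (R : realType) N (s : R) (c e : N.-tuple R) : R :=
  expR (- ((sqnorm (vadd c e) - sqnorm e) / (2 * s ^+ 2))).

Lemma measurable_normal_shift_weight d (Y : measurableType d) (R : realType) N s
    (c e : Y -> N.-tuple R) :
  measurable_fun setT c -> measurable_fun setT e ->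
  measurable_fun setT (fun y => normal_shift_weight R N s (c y) (e y)).
Proof.
move=> mc me; apply: measurableT_comp => //; apply: measurableT_comp => //.
apply: measurable_funM => //; apply: measurable_funB; apply: measurable_sqnorm => //.
exact: measurable_vadd.
Qed.

(** The squared norm is a sum over coordinates, so the weight is a product of one-dimensional
    weights and the coordinates can be shifted one after the other. *)
Lemma integral_iid_normal_shift (R : realType) N (s : R) (c : N.-tuple R)
    (F : N.-tuple R -> \bar R) :
  s != 0 -> measurable_fun setT F -> (forall e, 0 <= F e)%E ->
  (\int[iid_prob _ _ _ (gaussian R s) N]_e
     (F (vadd c e) * (normal_shift_weight R N s c e)%:E) =
   \int[iid_prob _ _ _ (gaussian R s) N]_e F e)%E.
Proof.
move=> s0; elim: N c F => [|N IH] c F mF F0.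
  apply: eq_integral => e _; rewrite /normal_shift_weight /sqnorm !big_ord0.
  rewrite subrr mul0r oppr0 expR0 mule1; congr F.
  by apply: eq_from_tnth => -[].
case/tupleP: c => c0 c.
have vaddE x (t : N.-tuple R) :
    vadd [tuple of c0 :: c] [tuple of x :: t] = [tuple of (c0 + x)%R :: vadd c t].
  apply: eq_from_tnth => i; rewrite tnth_mktuple.
  by case: (unliftP ord0 i) => [j|] ->; rewrite ?tnthS ?tnth_mktuple ?tnth0.
have sqE x (t : N.-tuple R) : sqnorm [tuple of x :: t] = x ^+ 2 + sqnorm t.
  rewrite /sqnorm big_ord_recl tnth0; congr (_ + _).
  by apply: eq_bigr => i _; rewrite tnthS.
have mW : measurable_fun setT (fun e => normal_shift_weight R N s c e).
  by apply: measurable_normal_shift_weight.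
have mW1 : measurable_fun setT (fun e => normal_shift_weight R N.+1 s [tuple of c0 :: c] e).
  by apply: measurable_normal_shift_weight.
have mcons y : measurable_fun [set: N.-tuple R] (fun t => [tuple of y :: t]).
  exact: measurable_cons.
(* The integral over the tail, as a function of the head: the one-dimensional shift applies to [K],
   and the induction hypothesis shifts the tail inside it. *)
pose K y := (\int[iid_prob _ _ _ (gaussian R s) N]_t F [tuple of y :: t])%E.
have mK : measurable_fun setT K.
  have mFc : measurable_fun [set: R * N.-tuple R] (F \o tcons _ R N).
    exact: measurableT_comp.
  exact: (@measurable_fun_fubini_tonelli_F _ _ _ _ R
    (iid_prob _ _ _ (gaussian R s) N) _ mFc (fun z => F0 _)).
have K0 y : (0 <= K y)%E by exact: integral_ge0.
rewrite [RHS]integral_iid_probS// -/K.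
rewrite ge0_integral_gaussian// -(integral_normal_shift R s c0 K s0 mK K0).
rewrite -ge0_integral_gaussian; last 2 first.
- apply: emeasurable_funM; first by apply: measurableT_comp => //; exact: measurable_funD.
  apply/measurable_EFinP/measurableT_comp => //; apply: measurableT_comp => //.
  apply: measurable_funM => //; apply: measurable_funB; apply: measurable_funX => //.
  exact: measurable_funD.
- by move=> x; rewrite mule_ge0// lee_fin expR_ge0.
rewrite integral_iid_probS; last 2 first.
- apply: emeasurable_funM; last exact/measurable_EFinP.
  apply: measurableT_comp => //; exact: measurable_vadd.
- by move=> t; rewrite mule_ge0// lee_fin expR_ge0.
apply: eq_integral => x _.
rewrite /K -(IH c (fun t => F [tuple of c0 + x :: t])); last 2 first.
- exact: (measurableT_comp mF (mcons (c0 + x))).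
- by move=> t; exact: F0.
have mv : measurable_fun setT (fun t : N.-tuple R => vadd c t).
  exact: measurable_vadd.
rewrite -ge0_integralZr//; last 2 first.
- apply: emeasurable_funM; last exact/measurable_EFinP.
  exact: (measurableT_comp mF (measurableT_comp (mcons (c0 + x)) mv)).
- by move=> t _; rewrite mule_ge0// lee_fin expR_ge0.
apply: eq_integral => t _; rewrite vaddE -muleA; congr (_ * _)%E.
rewrite -EFinM /normal_shift_weight vaddE !sqE -expRD; congr (expR _)%:E.
by field.
Qed.

(** * The exponential moment of the empirical divergence *)

Lemma measurable_expeR (R : realType) : measurable_fun setT (@expeR R).
Proof.
rewrite (_ : expeR = fun x => if x == +oo%E then +oo%E else
   if x == -oo%E then 0%E else (expR (fine x))%:E); last first.
  by apply/funext => -[].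
have meq (y : \bar R) : measurable_fun setT (fun x : \bar R => x == y).
  apply: (measurable_fun_bool true); rewrite setTI [X in measurable X](_ : _ = [set y]).
    exact: emeasurable_set1.
  by apply/seteqP; split=> x /= /eqP.
apply: measurable_fun_ifT => //; apply: measurable_fun_ifT => //.
apply/measurable_EFinP/measurableT_comp => //; exact: fine_measurable.
Qed.

Lemma measurable_xlogxy d (Y : measurableType d) (R : realType) (f g : Y -> R) :
  measurable_fun setT f -> measurable_fun setT g ->
  (forall y, 0 <= f y) -> (forall y, 0 <= g y) ->
  measurable_fun setT (fun y => xlogxy (f y) (g y)).
Proof.
move=> mf mg f0 g0.
(* In the last branch both values are positive, so the logarithm of the quotient splits into a
   difference whose measurability is immediate. *)
rewrite (_ : (fun y => _) = fun y => if f y == 0 then 0%E else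
    if g y == 0 then +oo%E else (f y * (ln (f y) - ln (g y)))%:E); last first.
  apply/funext => y; rewrite /xlogxy; case: eqP => // /eqP fy; case: eqP => // /eqP gy.
  by rewrite ln_div// posrE lt0r ?fy ?gy ?f0 ?g0.
apply: measurable_fun_ifT => //; first exact: measurable_fun_eqr.
apply: measurable_fun_ifT => //; first exact: measurable_fun_eqr.
apply/measurable_EFinP; apply: measurable_funM => //.
by apply: measurable_funB; exact: measurableT_comp.
Qed.

Lemma measurable_kl d (Y : measurableType d) (R : realType) (f g : Y -> R) :
  measurable_fun setT f -> measurable_fun setT g ->
  (forall y, 0 <= f y <= 1) -> (forall y, 0 <= g y <= 1) ->
  measurable_fun setT (fun y => kl (f y) (g y)).
Proof.
move=> mf mg f01 g01; apply: emeasurable_funD; apply: measurable_xlogxy => //.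
- by move=> y; case/andP: (f01 y).
- by move=> y; case/andP: (g01 y).
- exact: measurable_funB.
- exact: measurable_funB.
- by move=> y; rewrite subr_ge0; case/andP: (f01 y).
- by move=> y; rewrite subr_ge0; case/andP: (g01 y).
Qed.

(** Exchanging the two outcomes reduces mean 1 to mean 0. *)
Lemma klC (R : realType) (q p : R) : kl (1 - q) (1 - p) = kl q p.
Proof. by rewrite /kl !subKr addeC. Qed.

Lemma kl00 (R : realType) : kl (0 : R) 0 = 0%E.
Proof.
by rewrite /kl /xlogxy eqxx subr0 oner_eq0 divr1 ln1 mulr0 add0e.
Qed.

(** The convention for [0 log 0] costs nothing in the real formula, since the factor 0 cancels
    whatever value [ln] takes there. *)
Lemma klE (R : realType) (q p : R) : 0 < p < 1 ->
  kl q p = (q * ln (q / p) + (1 - q) * ln ((1 - q) / (1 - p)))%:E.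
Proof.
move=> /andP[p0 p1]; have p1' : 0 < 1 - p by rewrite subr_gt0.
rewrite /kl /xlogxy (gt_eqF p0) (gt_eqF p1') EFinD.
by congr (_ + _)%E; (case: eqP => [->|//]; rewrite mul0r).
Qed.

(** An instance of [integral_iid_prob_prod] with the factor 1 at every other coordinate. *)
Lemma integral_iid_prob_coord d (T : measurableType d) (R : realType)
    (m : probability T R) n (i : 'I_n) (f : T -> \bar R) :
  measurable_fun setT f -> (forall x, 0 <= f x)%E ->
  (\int[iid_prob _ _ _ m n]_t f (tnth t i) = \int[m]_x f x)%E.
Proof.
move=> mf f0.
pose F j x := if j == i then f x else 1%E.
have mF j : measurable_fun setT (F j) by rewrite /F; case: eqP.
have F0 j x : (0 <= F j x)%E by rewrite /F; case: eqP.
transitivity (\int[iid_prob _ _ _ m n]_t \prod_(j < n) F j (tnth t j))%E.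
  apply: eq_integral => t _; rewrite (bigD1 i)//= /F eqxx big1 ?mule1// => j.
  by move=> /negPf ->.
rewrite integral_iid_prob_prod// (bigD1 i)//= big1 ?mule1; last first.
  move=> j /negPf ji; rewrite (eq_integral (fun=> 1%E)) => [|x _]; last by rewrite /F ji.
  by rewrite integral_cst// mul1e; exact: probability_setT.
by apply: eq_integral => x _; rewrite /F eqxx.
Qed.

Section mgf_kl.
Context d (T : measurableType d) (R : realType) (m : probability T R) (n : nat).
Hypothesis n_gt0 : (0 < n)%N.

(** At fixed parameters [emp_risk] unfolds to the same term, so the results of this section apply to
    it by conversion. *)
Definition mean (g : T -> R) (t : n.-tuple T) : R :=
  n%:R^-1 * \sum_(i < n) g (tnth t i).

Lemma mean_itv (g : T -> R) t : (forall x, 0 <= g x <= 1) -> 0 <= mean g t <= 1.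
Proof.
move=> g01; have nR : 0 < n%:R :> R by rewrite ltr0n.
rewrite /mean mulr_ge0 ?invr_ge0//=; last first.
  by apply: sumr_ge0 => i _; case/andP: (g01 (tnth t i)).
rewrite mulrC ler_pdivrMr// mul1r (@le_trans _ _ (\sum_(i < n) 1))//.
  by apply: ler_sum => i _; case/andP: (g01 (tnth t i)).
by rewrite sumr_const card_ord.
Qed.

Lemma fine_integral_itv (g : T -> R) : measurable_fun setT g ->
  (forall x, 0 <= g x <= 1) ->
  exists2 p, 0 <= p <= 1 & (\int[m]_x (g x)%:E = p%:E)%E.
Proof.
move=> mg g01; have mg' : measurable_fun setT (EFin \o g) by exact/measurable_EFinP.
have I0 : (0 <= \int[m]_x (g x)%:E)%E.
  by apply: integral_ge0 => x _; rewrite lee_fin; case/andP: (g01 x).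
have I1 : (\int[m]_x (g x)%:E <= 1)%E.
  rewrite -(probability_setT m) -[leRHS]mul1e -integral_cst//.
  apply: ge0_le_integral => //.
  - by move=> x _; rewrite lee_fin; case/andP: (g01 x).
  - by move=> x _; rewrite lee_fin; case/andP: (g01 x).
have fI : (\int[m]_x (g x)%:E)%E \is a fin_num.
  by rewrite ge0_fin_numE// (le_lt_trans I1)// ltry.
exists (fine (\int[m]_x (g x)%:E)%E); last by rewrite fineK.
by rewrite -!lee_fin fineK// I0 I1.
Qed.

Lemma integral_onem (g : T -> R) p : measurable_fun setT g ->
  (forall x, 0 <= g x <= 1) -> (\int[m]_x (g x)%:E = p%:E)%E ->
  (\int[m]_x (1 - g x)%:E = (1 - p)%:E)%E.
Proof.
move=> mg g01 gp; rewrite (eq_integral (cst 1 \- (EFin \o g))%E)//.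
have ig : m.-integrable setT (EFin \o g).
  apply/integrableP; split; first exact/measurable_EFinP.
  rewrite (eq_integral (EFin \o g)); first by rewrite /= gp ltry.
  by move=> x _ /=; rewrite ger0_norm//; case/andP: (g01 x).
rewrite integralB//; last exact: finite_measure_integrable_cst.
rewrite [X in (_ - X)%E]gp integral_cst// mul1e EFinB; congr (_ - _)%E.
exact: probability_setT.
Qed.

Lemma measurable_expeR_kl (g : T -> R) p : measurable_fun setT g ->
  (forall x, 0 <= g x <= 1) -> 0 <= p <= 1 ->
  measurable_fun setT (fun t : n.-tuple T => expeR (n%:R%:E * kl (mean g t) p)).
Proof.
move=> mg g01 p01; apply: measurableT_comp; first exact: measurable_expeR.
apply: measurable_funeM; apply: measurable_kl => //.
  apply: measurable_funM => //; apply: measurable_sum => i.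
  by apply: measurableT_comp => //; exact: measurable_tnth.
by move=> t; exact: mean_itv.
Qed.

Lemma integral_expeR_kl_interior (g : T -> R) p : measurable_fun setT g ->
  (forall x, 0 <= g x <= 1) -> (\int[m]_x (g x)%:E = p%:E)%E -> 0 < p < 1 ->
  (\int[iid_prob _ _ _ m n]_t expeR (n%:R%:E * kl (mean g t) p) <=
   (2 * Num.sqrt n%:R)%:E)%E.
Proof.
move=> mg g01 gp p01; have /andP[p0 p1] := p01.
have p1' : 0 < 1 - p by rewrite subr_gt0.
have gge x : 0 <= g x by case/andP: (g01 x).
have gle x : 0 <= 1 - g x by rewrite subr_ge0; case/andP: (g01 x).
pose M k : R := (k%:R / n%:R) ^+ k * (1 - k%:R / n%:R) ^+ (n - k).
have M0 (J : {set 'I_n}) : 0 <= M #|J|.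
  have Jn : (#|J| <= n)%N by rewrite -[leqRHS]card_ord max_card.
  rewrite mulr_ge0 ?exprn_ge0 ?divr_ge0// subr_ge0 ler_pdivrMr ?ltr0n//.
  by rewrite mul1r ler_nat.
pose f (J : {set 'I_n}) i x : \bar R :=
  (if i \in J then g x / p else (1 - g x) / (1 - p))%:E.
have mfr (J : {set 'I_n}) i : measurable_fun setT (f J i).
  rewrite /f; case: (i \in J); apply/measurable_EFinP; apply: measurable_funM => //.
  exact: measurable_funB.
have f0 (J : {set 'I_n}) i x : (0 <= f J i x)%E.
  by rewrite lee_fin; case: ifP => _; rewrite divr_ge0// ltW.
(* Division by [p] or [1 - p] normalizes each factor to mean 1. *)
have f1 (J : {set 'I_n}) i : (\int[m]_x f J i x = 1)%E.
  rewrite /f; case: (i \in J).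
    under eq_integral do rewrite EFinM muleC.
    rewrite ge0_integralZl//; last 3 first.
    - exact/measurable_EFinP.
    - by move=> x _; rewrite lee_fin.
    - by rewrite lee_fin invr_ge0 ltW.
    by rewrite gp -EFinM mulVf ?gt_eqF.
  under eq_integral do rewrite EFinM muleC.
  rewrite ge0_integralZl//; last 3 first.
  - by apply/measurable_EFinP; exact: measurable_funB.
  - by move=> x _; rewrite lee_fin.
  - by rewrite lee_fin invr_ge0 ltW.
  by rewrite (integral_onem _ _ mg g01 gp) -EFinM mulVf// gt_eqF.
apply: (@le_trans _ _ (\int[iid_prob _ _ _ m n]_t
    \sum_(J : {set 'I_n}) (M #|J|)%:E * \prod_(i < n) f J i (tnth t i))%E).
  apply: ge0_le_integral => //.
  - by move=> t _; exact: expeR_ge0.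
  - by apply: measurable_expeR_kl => //; rewrite (ltW p0) (ltW p1).
  - apply: emeasurable_sum => J; apply: measurable_funeM.
    exact: measurable_tuple_prod.
  - move=> t _; rewrite klE// -EFinM /=.
    have x01 i : 0 <= g (tnth t i) <= 1 by exact: g01.
    have := expR_kl_le R n (fun i => g (tnth t i)) p (mean g t) n_gt0 x01 p01 erefl.
    rewrite -lee_fin; move/le_trans; apply.
    rewrite -sumEFin; apply: lee_sum => J _.
    by rewrite EFinM prodEFin.
rewrite ge0_integral_sum//; last 2 first.
- by move=> J; apply: measurable_funeM; exact: measurable_tuple_prod.
- by move=> J t _; rewrite mule_ge0// ?lee_fin//; exact: prode_ge0.
(* By independence each product integrates to 1, and only the constants [M] remain. *)
rewrite (eq_bigr (fun J : {set 'I_n} => (M #|J|)%:E)); last first.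
  move=> J _; rewrite ge0_integralZl//; last 3 first.
  - exact: measurable_tuple_prod.
  - by move=> t _; exact: prode_ge0.
  - by rewrite lee_fin.
  by rewrite integral_iid_prob_prod// big1 ?mule1.
rewrite sumEFin lee_fin; exact: sum_set_likelihood.
Qed.

(** A nonnegative loss of mean 0 vanishes almost surely, so the empirical mean is almost surely 0
    and the integrand is almost surely 1. *)
Lemma integral_expeR_kl0 (g : T -> R) : measurable_fun setT g ->
  (forall x, 0 <= g x <= 1) -> (\int[m]_x (g x)%:E = 0)%E ->
  (\int[iid_prob _ _ _ m n]_t expeR (n%:R%:E * kl (mean g t) 0) <=
   (2 * Num.sqrt n%:R)%:E)%E.
Proof.
move=> mg g01 gp.
have gge x : 0 <= g x by case/andP: (g01 x).
have mgi i : measurable_fun setT (fun t : n.-tuple T => (g (tnth t i))%:E).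
  by apply/measurable_EFinP; apply: measurableT_comp => //; exact: measurable_tnth.
have Sge (t : n.-tuple T) (P : pred 'I_n) :
    (0 <= \sum_(i < n | P i) +oo * (g (tnth t i))%:E)%E.
  by apply: sume_ge0 => i _; rewrite mule_ge0// lee_fin.
(* [B] is 0 where all losses of the sample vanish and [+oo] elsewhere, while its integral is 0
   because [+oo * 0 = 0]. Hence [1 + B] dominates the integrand everywhere and no null set has to be
   handled. *)
pose B (t : n.-tuple T) : \bar R := (\sum_(i < n) +oo * (g (tnth t i))%:E)%E.
apply: (@le_trans _ _ (\int[iid_prob _ _ _ m n]_t (1 + B t))%E).
  apply: ge0_le_integral => //.
  - by move=> t _; exact: expeR_ge0.
  - by apply: measurable_expeR_kl => //; rewrite lexx ler01.
  - apply: emeasurable_funD => //; apply: emeasurable_sum => i.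
    exact: measurable_funeM.
  - move=> t _; have [m0|m0] := eqVneq (mean g t) 0.
      by rewrite m0 kl00 mule0 expeR0 leeDl//; exact: Sge.
    have [i gi] : exists i, g (tnth t i) != 0.
      apply/existsP; apply: contraNT m0; rewrite negb_exists => /forallP g0.
      rewrite /mean big1 ?mulr0// => i _; apply/eqP.
      by have := g0 i; rewrite negbK.
    rewrite /B (bigD1 i)//= gt0_mulye ?lte_fin ?lt0r ?gi ?gge//.
    by rewrite addye ?addey ?leey// gt_eqF// (lt_le_trans _ (Sge _ _)).
rewrite ge0_integralD//; last 2 first.
- by move=> t _; exact: Sge.
- by apply: emeasurable_sum => i; exact: measurable_funeM.
rewrite integral_cst// mul1e /B ge0_integral_sum//; last 2 first.
- by move=> i; exact: measurable_funeM.
- by move=> i t _; rewrite mule_ge0// lee_fin.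
rewrite big1 => [|i _]; last first.
  rewrite ge0_integralZl//; last by move=> t _; rewrite lee_fin.
  rewrite (integral_iid_prob_coord _ _ _ m n i (EFin \o g)) ?gp ?mule0//.
  exact/measurable_EFinP.
rewrite adde0 [X in (X <= _)%E](_ : _ = 1%E); last exact: probability_setT.
have : 1 <= Num.sqrt n%:R :> R by rewrite -[leLHS]sqrtr1 ler_wsqrtr// ler1n.
rewrite lee_fin; lra.
Qed.

Lemma mean_onem (g : T -> R) t : mean (fun x => 1 - g x) t = 1 - mean g t.
Proof.
rewrite /mean sumrB sumr_const card_ord mulrBr mulVf// pnatr_eq0 -lt0n.
exact: n_gt0.
Qed.

(** The mean lies in [[0, 1]]. The endpoints need their own argument since [p] and [1 - p] are
    denominators in the interior case; [p = 1] is [p = 0] for the loss [1 - g]. *)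
Lemma integral_expeR_kl (g : T -> R) p : measurable_fun setT g ->
  (forall x, 0 <= g x <= 1) -> (\int[m]_x (g x)%:E = p%:E)%E ->
  (\int[iid_prob _ _ _ m n]_t expeR (n%:R%:E * kl (mean g t) p) <=
   (2 * Num.sqrt n%:R)%:E)%E.
Proof.
move=> mg g01 gp; have [p' /andP[p0 p1]] := fine_integral_itv g mg g01.
rewrite gp => -[pp']; rewrite -pp' in p0 p1 => {p' pp'}.
have [p00|pn0] := eqVneq p 0.
  by rewrite p00; apply: integral_expeR_kl0; rewrite // gp p00.
have [p11|pn1] := eqVneq p 1.
  rewrite (eq_integral (fun t => expeR (n%:R%:E * kl (mean (fun x => (1 - g x)%R) t) 0))%E).
    apply: integral_expeR_kl0; first exact: measurable_funB.
      by move=> x; have := g01 x; lra.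
    by rewrite (integral_onem g p)// p11 subrr.
  by move=> t _; rewrite mean_onem -[in RHS](subrr (1:R)) klC p11.
by apply: integral_expeR_kl_interior => //; rewrite !lt_neqAle pn1 p0 p1 eq_sym pn0.
Qed.
End mgf_kl.

(** * Averaging over the sample and the noise *)

Section pac_bayes.
Context (R : realType) (d : measure_display) (T : measurableType d)
  (D : probability T R) (n Np Nt : nat).
Variable l : Np.-tuple R -> Nt.-tuple R -> T -> R.
Hypotheses (n_gt0 : (0 < n)%N)
  (l_meas : measurable_fun setT
     (fun z : (Np.-tuple R * Nt.-tuple R) * T => l z.1.1 z.1.2 z.2))
  (l_bnd : forall a b x, 0 <= l a b x <= 1).

Lemma measurable_loss d' (Y : measurableType d') (a : Y -> Np.-tuple R)
    (b : Y -> Nt.-tuple R) (x : Y -> T) :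
  measurable_fun setT a -> measurable_fun setT b -> measurable_fun setT x ->
  measurable_fun setT (fun y => l (a y) (b y) (x y)).
Proof.
move=> ma mb mx.
have mabx : measurable_fun setT (fun y => ((a y, b y), x y)).
  apply/measurable_fun_pairP; split=> //; exact/measurable_fun_pairP.
exact: (measurableT_comp l_meas mabx).
Qed.

Lemma measurable_emp_risk d' (Y : measurableType d') (s : Y -> n.-tuple T)
    (a : Y -> Np.-tuple R) (b : Y -> Nt.-tuple R) :
  measurable_fun setT s -> measurable_fun setT a -> measurable_fun setT b ->
  measurable_fun setT (fun y => emp_risk l (s y) (a y) (b y)).
Proof.
move=> ms ma mb; apply: measurable_funM => //; apply: measurable_sum => i.
apply: measurable_loss => //.
exact: (measurableT_comp (measurable_tnth i) ms).
Qed.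

Lemma riskE a b : (\int[D]_x (l a b x)%:E = (risk D l a b)%:E)%E.
Proof.
have mab : measurable_fun setT (l a b) by exact: measurable_loss.
have [p _ lp] := fine_integral_itv _ _ _ D (l a b) mab (l_bnd a b).
by rewrite /risk lp.
Qed.

Lemma risk_itv a b : 0 <= risk D l a b <= 1.
Proof.
have mab : measurable_fun setT (l a b) by exact: measurable_loss.
have [p p01 lp] := fine_integral_itv _ _ _ D (l a b) mab (l_bnd a b).
by rewrite /risk lp.
Qed.

Lemma measurable_risk d' (Y : measurableType d') (a : Y -> Np.-tuple R) (b : Y -> Nt.-tuple R) :
  measurable_fun setT a -> measurable_fun setT b ->
  measurable_fun setT (fun y => risk D l (a y) (b y)).
Proof.
move=> ma mb.
have mF : measurable_fun [set: Y * T] (fun z => (l (a z.1) (b z.1) z.2)%:E).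
  apply/measurable_EFinP; apply: measurable_loss => //.
    exact: (measurableT_comp ma measurable_fst).
  exact: (measurableT_comp mb measurable_fst).
have F0 (z : Y * T) : (0 <= (l (a z.1) (b z.1) z.2)%:E)%E.
  by rewrite lee_fin; case/andP: (l_bnd (a z.1) (b z.1) z.2).
have mI := @measurable_fun_fubini_tonelli_F _ _ _ _ R D _ mF F0.
exact: (measurableT_comp (fine_measurable measurableT) mI).
Qed.

Lemma measurable_risk_kl d' (Y : measurableType d') (s : Y -> n.-tuple T)
    (a : Y -> Np.-tuple R) (b : Y -> Nt.-tuple R) :
  measurable_fun setT s -> measurable_fun setT a -> measurable_fun setT b ->
  measurable_fun setT
    (fun y => kl (emp_risk l (s y) (a y) (b y)) (risk D l (a y) (b y))).
Proof.
move=> ms ma mb; apply: measurable_kl => [|||y].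
- exact: measurable_emp_risk.
- exact: measurable_risk.
- by move=> y; apply: mean_itv.
- exact: risk_itv.
Qed.

Definition exp_kl (s : n.-tuple T) (a : Np.-tuple R) (b : Nt.-tuple R) : \bar R :=
  expeR (n%:R%:E * kl (emp_risk l s a b) (risk D l a b)).

Lemma measurable_exp_kl d' (Y : measurableType d') (s : Y -> n.-tuple T)
    (a : Y -> Np.-tuple R) (b : Y -> Nt.-tuple R) :
  measurable_fun setT s -> measurable_fun setT a -> measurable_fun setT b ->
  measurable_fun setT (fun y => exp_kl (s y) (a y) (b y)).
Proof.
move=> ms ma mb; apply: measurableT_comp; first exact: measurable_expeR.
by apply: measurable_funeM; exact: measurable_risk_kl.
Qed.

Context (phi0 : Np.-tuple R) (theta0 : Nt.-tuple R) (sp st : R).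
Hypotheses (sp0 : sp != 0) (st0 : st != 0).
Context (alg_phi : n.-tuple T -> Np.-tuple R) (alg_theta : n.-tuple T -> Nt.-tuple R).
Hypotheses (alg_phi_meas : measurable_fun setT alg_phi)
  (alg_theta_meas : measurable_fun setT alg_theta).

(** The variable for Markov's inequality: where the divergence is finite, its logarithm divided by
    [n] is the divergence minus the two norm terms of the bound. *)
Definition weighted_exp_kl (z : n.-tuple T * (Np.-tuple R * Nt.-tuple R)) : \bar R :=
  (exp_kl z.1 (vadd (alg_phi z.1) z.2.1) (vadd (alg_theta z.1) z.2.2) *
   (normal_shift_weight R Np sp (vsub (alg_phi z.1) phi0) z.2.1)%:E *
   (normal_shift_weight R Nt st (vsub (alg_theta z.1) theta0) z.2.2)%:E)%E.

Lemma measurable_weighted_exp_kl : measurable_fun setT weighted_exp_kl.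
Proof.
have m1 : measurable_fun [set: n.-tuple T * (Np.-tuple R * Nt.-tuple R)] (fun z => z.1).
  exact: measurable_fst.
have m2 : measurable_fun [set: n.-tuple T * (Np.-tuple R * Nt.-tuple R)] (fun z => z.2.1).
  exact: (measurableT_comp measurable_fst measurable_snd).
have m3 : measurable_fun [set: n.-tuple T * (Np.-tuple R * Nt.-tuple R)] (fun z => z.2.2).
  exact: (measurableT_comp measurable_snd measurable_snd).
have mp := measurableT_comp alg_phi_meas m1.
have mt := measurableT_comp alg_theta_meas m1.
apply: emeasurable_funM; first apply: emeasurable_funM.
- by apply: measurable_exp_kl => //; exact: measurable_vadd.
- by apply/measurable_EFinP; apply: measurable_normal_shift_weight => //; exact: measurable_vsub.
- by apply/measurable_EFinP; apply: measurable_normal_shift_weight => //; exact: measurable_vsub.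
Qed.

Lemma weighted_exp_kl_ge0 z : (0 <= weighted_exp_kl z)%E.
Proof.
rewrite /weighted_exp_kl; apply: mule_ge0; last by rewrite lee_fin expR_ge0.
by apply: mule_ge0; [exact: expeR_ge0|rewrite lee_fin expR_ge0].
Qed.

Lemma vadd_vsub N (a c e : N.-tuple R) : vadd c (vadd (vsub a c) e) = vadd a e.
Proof. by apply: eq_from_tnth => i; rewrite !tnth_mktuple; ring. Qed.

Lemma integral_weighted_exp_kl :
  (\int[iid_prob _ _ _ D n]_s \int[iid_prob _ _ _ (gaussian R sp) Np]_e
    \int[iid_prob _ _ _ (gaussian R st) Nt]_f weighted_exp_kl (s, (e, f)) <=
   (2 * Num.sqrt n%:R)%:E)%E.
Proof.
have mvadd N (c : N.-tuple R) : measurable_fun setT (vadd c) by exact: measurable_vadd.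
have mkl s : measurable_fun [set: Np.-tuple R * Nt.-tuple R]
    (fun z => exp_kl s (vadd phi0 z.1) (vadd theta0 z.2)).
  apply: measurable_exp_kl => //.
    exact: (measurableT_comp (mvadd _ phi0) measurable_fst).
  exact: (measurableT_comp (mvadd _ theta0) measurable_snd).
(* The [theta] noise is integrated out around the prior mean, while the first parameter [e] remains
   free. *)
pose K s e := (\int[iid_prob _ _ _ (gaussian R st) Nt]_f exp_kl s e (vadd theta0 f))%E.
have mKf s e : measurable_fun setT (fun f => exp_kl s e f).
  exact: measurable_exp_kl.
(* The [theta] shift is removed first, with the [phi] noise fixed, so that the [phi] weight is a
   constant factor. *)
have step_theta s e : (\int[iid_prob _ _ _ (gaussian R st) Nt]_f
    weighted_exp_kl (s, (e, f)) = K s (vadd (alg_phi s) e) *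
      (normal_shift_weight R Np sp (vsub (alg_phi s) phi0) e)%:E)%E.
  pose F f := exp_kl s (vadd (alg_phi s) e) (vadd theta0 f).
  have mF : measurable_fun setT F by exact: (measurableT_comp (mKf _ _) (mvadd _ theta0)).
  have F0 f : (0 <= F f)%E by exact: expeR_ge0.
  pose H f := (F (vadd (vsub (alg_theta s) theta0) f) *
    (normal_shift_weight R Nt st (vsub (alg_theta s) theta0) f)%:E)%E.
  have mH : measurable_fun setT H.
    apply: emeasurable_funM; last by apply/measurable_EFinP; exact: measurable_normal_shift_weight.
    exact: (measurableT_comp mF (mvadd _ _)).
  have H0 f : setT f -> (0 <= H f)%E by move=> _; apply: mule_ge0; rewrite ?F0// lee_fin expR_ge0.
  have w0 : (0 <= (normal_shift_weight R Np sp (vsub (alg_phi s) phi0) e)%:E)%E.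
    by rewrite lee_fin expR_ge0.
  have KE : K s (vadd (alg_phi s) e) = (\int[iid_prob _ _ _ (gaussian R st) Nt]_f H f)%E.
    by rewrite /H (integral_iid_normal_shift R Nt st (vsub (alg_theta s) theta0) F st0 mF F0).
  rewrite KE -(ge0_integralZr _ measurableT mH H0 w0).
  apply: eq_integral => f _; rewrite /weighted_exp_kl /H /F /= vadd_vsub.
  by rewrite muleAC.
pose mm : probability (Np.-tuple R * Nt.-tuple R)%type R :=
  (iid_prob _ _ _ (gaussian R sp) Np \x iid_prob _ _ _ (gaussian R st) Nt)%E.
(* After the [phi] shift the output of the algorithm no longer occurs, and [s] enters only through
   the empirical risk. *)
have step_phi s : (\int[iid_prob _ _ _ (gaussian R sp) Np]_e
    \int[iid_prob _ _ _ (gaussian R st) Nt]_f weighted_exp_kl (s, (e, f)) =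
    \int[mm]_z exp_kl s (vadd phi0 z.1) (vadd theta0 z.2))%E.
  rewrite (@fubini_tonelli1 _ _ _ _ R (iid_prob _ _ _ (gaussian R sp) Np)
    (iid_prob _ _ _ (gaussian R st) Nt) _ (mkl s) (fun z => expeR_ge0 _)).
  pose F e := K s (vadd phi0 e).
  have mF : measurable_fun setT F.
    exact: (@measurable_fun_fubini_tonelli_F _ _ _ _ R
      (iid_prob _ _ _ (gaussian R st) Nt) _ (mkl s) (fun z => expeR_ge0 _)).
  have F0 e : (0 <= F e)%E by apply: integral_ge0 => f _; exact: expeR_ge0.
  rewrite -[RHS](integral_iid_normal_shift R Np sp (vsub (alg_phi s) phi0) F sp0 mF F0).
  by apply: eq_integral => e _; rewrite step_theta /F vadd_vsub.
under eq_integral do rewrite step_phi.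
pose G (z : n.-tuple T * (Np.-tuple R * Nt.-tuple R)) :=
  exp_kl z.1 (vadd phi0 z.2.1) (vadd theta0 z.2.2).
have mG : measurable_fun setT G.
  apply: measurable_exp_kl => //.
    exact: (measurableT_comp (mvadd _ phi0) (measurableT_comp measurable_fst measurable_snd)).
  exact: (measurableT_comp (mvadd _ theta0) (measurableT_comp measurable_snd measurable_snd)).
have G0 z : (0 <= G z)%E by exact: expeR_ge0.
(* The sample integral moves inside, where the parameters are fixed and the losses are i.i.d. *)
rewrite (@fubini_tonelli _ _ _ _ R (iid_prob _ _ _ D n) mm G mG G0).
apply: (@le_trans _ _ (\int[mm]_z (2 * Num.sqrt n%:R)%:E)%E); last first.
  rewrite integral_cst// [X in (_ * X)%E](_ : _ = 1%E) ?mule1//.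
  exact: probability_setT.
have mGint := @measurable_fun_fubini_tonelli_G _ _ _ _ R (iid_prob _ _ _ D n) _ mG G0.
have bound z : (fubini_G (iid_prob _ _ _ D n) G z <= (2 * Num.sqrt n%:R)%:E)%E.
  have mz : measurable_fun setT (l (vadd phi0 z.1) (vadd theta0 z.2)).
    exact: measurable_loss.
  exact: (integral_expeR_kl _ _ _ D n n_gt0 _ _ mz (l_bnd _ _) (riskE _ _)).
apply: ge0_le_integral => //.
  by move=> z _; apply: integral_ge0 => s _; exact: G0.
by move=> z _; exact: bound.
Qed.
End pac_bayes.

(** * The high-probability bound by Markov's inequality *)

Theorem theorem4
  (R : realType) (d : measure_display) (T : measurableType d)
  (D : probability T R)
  (dO : measure_display) (Omega : measurableType dO) (P : probability Omega R)
  (n Np Nt : nat) (n_gt0 : (0 < n)%N) (Np_gt0 : (0 < Np)%N) (Nt_gt0 : (0 < Nt)%N)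
  (l : Np.-tuple R -> Nt.-tuple R -> T -> R)
  (l_meas : measurable_fun setT
     (fun z : (Np.-tuple R * Nt.-tuple R) * T => l z.1.1 z.1.2 z.2))
  (l_bnd : forall a b x, 0 <= l a b x <= 1)
  (delta : R) (delta_gt0 : 0 < delta) (delta_lt1 : delta < 1)
  (phi0 : Np.-tuple R) (theta0 : Nt.-tuple R)
  (sp st : R) (sp_gt0 : 0 < sp) (st_gt0 : 0 < st)
  (alg_phi : n.-tuple T -> Np.-tuple R) (alg_theta : n.-tuple T -> Nt.-tuple R)
  (alg_phi_meas : measurable_fun setT alg_phi)
  (alg_theta_meas : measurable_fun setT alg_theta)
  (X : 'I_n -> Omega -> T) (ep : 'I_Np -> Omega -> R) (et : 'I_Nt -> Omega -> R)
  (X_meas : forall i, measurable_fun setT (X i))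
  (ep_meas : forall j, measurable_fun setT (ep j))
  (et_meas : forall k, measurable_fun setT (et k))
  (X_law : forall i A, measurable A -> P (X i @^-1` A) = D A)
  (ep_law : forall j B, measurable B -> P (ep j @^-1` B) = normal_prob 0 sp B)
  (et_law : forall k C, measurable C -> P (et k @^-1` C) = normal_prob 0 st C)
  (indep : mutually_independent P X ep et) :
  let S := fun w => [tuple X i w | i < n] in
  let eps_phi := fun w => [tuple ep j w | j < Np] in
  let eps_theta := fun w => [tuple et k w | k < Nt] in
  ((1 - delta)%:E <=
   P [set w | kl
      (emp_risk l (S w) (vadd (alg_phi (S w)) (eps_phi w))
                        (vadd (alg_theta (S w)) (eps_theta w)))
      (risk D l (vadd (alg_phi (S w)) (eps_phi w))
                (vadd (alg_theta (S w)) (eps_theta w)))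
    <= ((sqnorm (vadd (vsub (alg_phi (S w)) phi0) (eps_phi w))
           - sqnorm (eps_phi w)) / (2 * sp ^+ 2 * n%:R)
        + (sqnorm (vadd (vsub (alg_theta (S w)) theta0) (eps_theta w))
           - sqnorm (eps_theta w)) / (2 * st ^+ 2 * n%:R)
        + ln (2 * Num.sqrt (n%:R) / delta) / n%:R)%:E])%E.
Proof.
pose S w := [tuple X i w | i < n].
pose eps_phi w := [tuple ep j w | j < Np].
pose eps_theta w := [tuple et k w | k < Nt].
pose k w := kl
  (emp_risk l (S w) (vadd (alg_phi (S w)) (eps_phi w)) (vadd (alg_theta (S w)) (eps_theta w)))
  (risk D l (vadd (alg_phi (S w)) (eps_phi w)) (vadd (alg_theta (S w)) (eps_theta w))).
pose b w :=
  (sqnorm (vadd (vsub (alg_phi (S w)) phi0) (eps_phi w)) - sqnorm (eps_phi w))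
    / (2 * sp ^+ 2 * n%:R) +
  (sqnorm (vadd (vsub (alg_theta (S w)) theta0) (eps_theta w)) - sqnorm (eps_theta w))
    / (2 * st ^+ 2 * n%:R) + ln (2 * Num.sqrt n%:R / delta) / n%:R.
pose good := [set w | (k w <= (b w)%:E)%E].
change ((1 - delta)%:E <= P good)%E.
have spn0 : sp != 0 by rewrite gt_eqF.
have stn0 : st != 0 by rewrite gt_eqF.
have nR : 0 < n%:R :> R by rewrite ltr0n.
(* Markov's threshold: the bound [2 sqrt n] on the expectation of [W], divided by [delta]. *)
set a := 2 * Num.sqrt n%:R / delta.
have a0 : 0 < a by rewrite divr_gt0// mulr_gt0// sqrtr_gt0.
have mS : measurable_fun setT S by exact: measurable_tuple_of.
have mep : measurable_fun setT eps_phi by exact: measurable_tuple_of.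
have met : measurable_fun setT eps_theta by exact: measurable_tuple_of.
have mphi := measurableT_comp alg_phi_meas mS.
have mtheta := measurableT_comp alg_theta_meas mS.
pose W w := weighted_exp_kl R d T D n Np Nt l phi0 theta0 sp st alg_phi alg_theta
  (S w, (eps_phi w, eps_theta w)).
have mWz := measurable_weighted_exp_kl R d T D n Np Nt l n_gt0 l_meas l_bnd
  phi0 theta0 sp st alg_phi alg_theta alg_phi_meas alg_theta_meas.
have W0 w : (0 <= W w)%E by exact: weighted_exp_kl_ge0.
have mW : measurable_fun setT W.
  apply: (measurableT_comp mWz); apply/measurable_fun_pairP; split => //.
  exact/measurable_fun_pairP.
have intW : (\int[P]_w W w <= (2 * Num.sqrt n%:R)%:E)%E.
  rewrite (integral_sample_noise R d T D (gaussian R sp) (gaussian R st) dO Omega P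
    n Np Nt X ep et X_meas ep_meas et_meas X_law ep_law et_law indep _ mWz).
    exact: integral_weighted_exp_kl.
  by move=> z; exact: weighted_exp_kl_ge0.
have mk : measurable_fun setT k.
  by apply: measurable_risk_kl => //; exact: measurable_vadd.
have mb : measurable_fun setT b.
  apply: measurable_funD => //; apply: measurable_funD; apply: measurable_funM => //;
    apply: measurable_funB; apply: measurable_sqnorm => //; apply: measurable_vadd => //;
    exact: measurable_vsub.
have mgood : measurable good.
  rewrite -[X in measurable X]setTI; apply: measurable_lee => //.
  exact/measurable_EFinP.
have mbad := measurableC mgood.
have Wbad w : (~` good) w -> (a%:E <= W w)%E.
  move=> /negP; rewrite -ltNge => bk.
  (* The norm terms of [n * b w] cancel the exponents of the two weights, which leaves [ln a]. *)
  have -> : a%:E = (expR (n%:R * b w) *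
      normal_shift_weight R Np sp (vsub (alg_phi (S w)) phi0) (eps_phi w) *
      normal_shift_weight R Nt st (vsub (alg_theta (S w)) theta0) (eps_theta w))%:E.
    congr EFin; rewrite -[LHS]lnK ?posrE// -!expRD; congr expR.
    by rewrite /b -/a; field; rewrite spn0 stn0 gt_eqF.
  rewrite 2!EFinM; apply: lee_wpmul2r; first by rewrite lee_fin expR_ge0.
  apply: lee_wpmul2r; first by rewrite lee_fin expR_ge0.
  rewrite -[leLHS]/(expeR (n%:R * b w)%:E) lee_expeR EFinM.
  by apply: lee_wpmul2l; [rewrite lee_fin ltW|exact: ltW].
(* Markov's inequality: [a] times the probability of the bad event is at most the integral of [W]
   over it, hence at most [2 sqrt n = a * delta]. *)
have Pbad : (P (~` good) <= delta%:E)%E.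
  rewrite -(@lee_pmul2l _ a%:E)//.
  rewrite -integral_cst//; apply: (@le_trans _ _ (\int[P]_w W w)%E); last first.
    apply: (le_trans intW); rewrite lee_fin /a mulfVK// gt_eqF//.
  apply: (@le_trans _ _ (\int[P]_(w in ~` good) W w)%E).
    apply: ge0_le_integral => //.
    - by move=> w _; rewrite lee_fin ltW.
    - exact: measurable_funTS.
  by apply: ge0_subset_integral => //.
rewrite -[good]setCK probability_setC// EFinB.
exact: leeB.
Qed.
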